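(* Let $S=\{s_1,\dots,s_{|S|}\}$ be a finite set, $G=G_S$ the free group on $S$, and let $p_i>0$, $q_i=1+\frac{p_i}{100}$ for $i=1,\dots,|S|$. Consider the multi-dimensional-time dynamical system (MDTDS) on $X=(0,+\infty)$ generated by the functions $f_i(x)=q_ix$, $i=1,\dots,|S|$. Let $H$ be a subgroup of $G$. A point $x\in(0,+\infty)$ is $H$-periodic for this MDTDS if and only if $$q_{j_1}^{\delta_1}q_{j_2}^{\delta_2}\cdots q_{j_m}^{\delta_m}=1$$ for every $y=s_{j_1}^{\delta_1}\cdots s_{j_m}^{\delta_m}\in H$.
   Context: For $t=s_{i_1}^{\varepsilon_1}\cdots s_{i_n}^{\varepsilon_n}\in G$ with $\varepsilon_j\in\mathbb{Z}$ and $x\in X$, $D_t(x)=f_{i_n}^{\varepsilon_n}(\cdots f_{i_1}^{\varepsilon_1}(x)\cdots)=q_{i_n}^{\varepsilon_n}\cdots q_{i_1}^{\varepsilon_1}x$. For a subgroup $H$ of $G$, a point $x\in X$ is called $H$-periodic if $D_{rt}(x)=D_t(x)$ for all $t\in G$ and all $r\in H$. *)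

(* Defs.v *)
From HB Require Import structures.
From mathcomp Require Import all_boot all_order all_algebra.
From mathcomp Require Import interval_inference classical_sets reals.

Set Implicit Arguments.
Unset Strict Implicit.
Unset Printing Implicit Defensive.

Import GRing.Theory Num.Theory.

Local Open Scope group_scope.

(* The free group on S, as the group of reduced words. A letter (s, false)
   stands for s and (s, true) for its inverse. *)
Section FreeGroup.
Variable S : choiceType.
Implicit Types (a b : S * bool) (u v w : seq (S * bool)).

Definition letter_inv a : S * bool := (a.1, ~~ a.2).

Definition reduced w : bool := sorted (fun a b => b != letter_inv a) w.

Record freegroup := FreeGroup {
  fg_word :> seq (S * bool);
  fg_wordP : reduced fg_word
}.

HB.instance Definition _ := [isSub for fg_word].
HB.instance Definition _ := [Choice of freegroup by <:].

Definition push a w : seq (S * bool) :=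
  if w is b :: w' then if b == letter_inv a then w' else a :: w else [:: a].

Definition pushes u w : seq (S * bool) := foldr push w u.

Lemma letter_invK : involutive letter_inv.
Proof. by case=> s b; rewrite /letter_inv /= negbK. Qed.

Lemma letter_inv_neq a : (a == letter_inv a) = false.
Proof. by case: a => s []; apply/eqP => -[]. Qed.

Lemma reduced_behead a w : reduced (a :: w) -> reduced w.
Proof. exact: path_sorted. Qed.

Lemma reduced_push a w : reduced w -> reduced (push a w).
Proof.
case: w => [//|b w] rw /=; case: ifP => [_|ba]; first exact: reduced_behead rw.
by rewrite /reduced /= ba.
Qed.

Lemma reduced_pushes u w : reduced w -> reduced (pushes u w).
Proof. by move=> rw; elim: u => //= a u; apply: reduced_push. Qed.

Lemma push_reduced a w : reduced (a :: w) -> push a w = a :: w.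
Proof. by case: w => [//|b w] /= /andP[/negbTE ->]. Qed.

Lemma pushK a w : reduced w -> push (letter_inv a) (push a w) = w.
Proof.
case: w => [|b w] rw /=; first by rewrite letter_invK eqxx.
case: ifP => [/eqP ba|_] /=; last by rewrite letter_invK eqxx.
by rewrite -ba push_reduced.
Qed.

Lemma pushes_reduced u : reduced u -> pushes u [::] = u.
Proof.
elim: u => //= a u IHu rau; rewrite IHu ?push_reduced //.
exact: reduced_behead rau.
Qed.

Lemma pushes_push a u w : reduced w ->
  pushes (push a u) w = push a (pushes u w).
Proof.
case: u => [|b u] rw //=; case: ifP => [/eqP ->|//].
by have := pushK (letter_inv a) (reduced_pushes u rw); rewrite letter_invK => ->.
Qed.

Lemma pushes_pushes u v w : reduced w ->
  pushes (pushes u v) w = pushes u (pushes v w).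
Proof. by move=> rw; elim: u => //= a u IHu; rewrite pushes_push // IHu. Qed.

Definition word_inv u : seq (S * bool) := rev (map letter_inv u).

Lemma reduced_word_inv u : reduced u -> reduced (word_inv u).
Proof.
rewrite /reduced /word_inv rev_sorted sorted_map.
case: u => //= a u; apply: sub_path => b c /=; apply: contra => /eqP ->.
by rewrite letter_invK.
Qed.

Definition fg_one := FreeGroup (isT : reduced [::]).
Definition fg_mul (x y : freegroup) :=
  FreeGroup (reduced_pushes x (fg_wordP y)).
Definition fg_inv (x : freegroup) := FreeGroup (reduced_word_inv (fg_wordP x)).

Lemma fg_mulA : associative fg_mul.
Proof.
move=> x y z; apply: val_inj => /=; rewrite pushes_pushes //; exact: fg_wordP.
Qed.

Lemma fg_mul1 : left_id fg_one fg_mul.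
Proof. by move=> x; apply: val_inj. Qed.

Lemma fg_mulr1 : right_id fg_one fg_mul.
Proof. by move=> x; apply/val_inj/pushes_reduced/fg_wordP. Qed.

Lemma fg_mulV : left_inverse fg_one fg_inv fg_mul.
Proof.
case=> u ru; apply: val_inj => /=; elim: u ru => //= a u IHu rau.
rewrite /word_inv /= rev_cons -cats1 /pushes foldr_cat /=.
by rewrite letter_invK eqxx; apply/IHu/(reduced_behead rau).
Qed.

Lemma fg_invK : involutive fg_inv.
Proof.
move=> x; apply: val_inj; rewrite /= /word_inv map_rev revK -map_comp.
by rewrite (eq_map (g := id)) ?map_id //; apply: letter_invK.
Qed.

Lemma fg_mulrV : right_inverse fg_one fg_inv fg_mul.
Proof. by move=> x; rewrite -{1}[x]fg_invK fg_mulV. Qed.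

HB.instance Definition _ := isGroup.Build freegroup
  fg_mulA fg_mul1 fg_mulr1 fg_mulV fg_mulrV.

Definition fg_gen (s : S) : freegroup :=
  FreeGroup (isT : reduced [:: (s, false)]).

End FreeGroup.

Definition expgz (G : groupType) (x : G) (k : int) : G :=
  match k with Posz n => x ^+ n | Negz n => x ^- n.+1 end.

(* The element s_{i_1}^{e_1} ... s_{i_n}^{e_n}; the expression
   [:: (i_1, e_1); ...; (i_n, e_n)] need not be reduced. *)
Definition fg_eval (S : choiceType) (w : seq (S * int)) : freegroup S :=
  \prod_(a <- w) expgz (fg_gen a.1) a.2.

(* A multi-dimensional-time dynamical system on X with time G_S is given by
   bijections f_s : X -> X. *)
Record mdtds (S : choiceType) (X : Type) := Mdtds {
  md_fun : S -> X -> X;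
  md_inv : S -> X -> X;
  md_funK : forall s, cancel (md_fun s) (md_inv s);
  md_invK : forall s, cancel (md_inv s) (md_fun s)
}.

Section Mdtds.
Variables (S : choiceType) (X : Type) (M : mdtds S X).

Definition md_letter (a : S * bool) : X -> X :=
  if a.2 then md_inv M a.1 else md_fun M a.1.

(* D_t, computed on the reduced expression of t: the leftmost letter of t acts
   first. By md_act_eval below any other expression of t gives the same map. *)
Definition md_act (t : freegroup S) (x : X) : X :=
  foldl (fun y a => md_letter a y) x t.

Definition md_iterz (s : S) (k : int) : X -> X :=
  match k with Posz n => iter n (md_fun M s) | Negz n => iter n.+1 (md_inv M s) end.

Definition periodic (H : set (freegroup S)) (x : X) : Prop :=
  forall t r : freegroup S, H r -> md_act (r * t) x = md_act t x.

Lemma md_letterK a : cancel (md_letter a) (md_letter (letter_inv a)).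
Proof. by case: a => s [] x; rewrite /md_letter /= ?md_funK ?md_invK. Qed.

Lemma md_actM r t x : md_act (r * t) x = md_act t (md_act r x).
Proof.
rewrite /md_act [fg_word (r * t)]/=; case: r => /= u _.
elim: u x => //= a u IHu x; rewrite -IHu.
case: (pushes u t) => [//|b w] /=; case: ifP => //= /eqP ->.
by rewrite md_letterK.
Qed.

Lemma md_actV t x : md_act t^-1 (md_act t x) = x.
Proof. by rewrite -md_actM mulgV. Qed.

Lemma md_act_expgz s k x : md_act (expgz (fg_gen s) k) x = md_iterz s k x.
Proof.
have pos n y : md_act (fg_gen s ^+ n) y = iter n (md_fun M s) y.
  by elim: n y => // n IHn y; rewrite expgSr md_actM IHn.
case: k => n; rewrite /expgz /md_iterz //.
have iterK m y : iter m (md_fun M s) (iter m (md_inv M s) y) = y.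
  by elim: m y => // m IHm y; rewrite iterSr /= md_invK IHm.
by rewrite -{1}[x](iterK n.+1) -pos md_actV.
Qed.

Lemma md_act_eval (w : seq (S * int)) x :
  md_act (fg_eval w) x = foldl (fun y a => md_iterz a.1 a.2 y) x w.
Proof.
rewrite /fg_eval; elim: w x => [|a w IHw] x; first by rewrite big_nil.
by rewrite big_cons md_actM IHw md_act_expgz.
Qed.

End Mdtds.

Section Scaling.
Local Open Scope ring_scope.
Variables (R : realType) (S : choiceType) (q : S -> {posnum R}).

Definition scaling_fun s (x : {posnum R}) : {posnum R} :=
  ((q s)%:num * x%:num)%:pos.
Definition scaling_inv s (x : {posnum R}) : {posnum R} :=
  ((q s)%:num^-1 * x%:num)%:pos.

Lemma scaling_funK s : cancel (scaling_fun s) (scaling_inv s).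
Proof. by move=> x; apply: val_inj; rewrite /= mulKf. Qed.

Lemma scaling_invK s : cancel (scaling_inv s) (scaling_fun s).
Proof. by move=> x; apply: val_inj; rewrite /= mulVKf. Qed.

Definition scaling_mdtds : mdtds S {posnum R} :=
  Mdtds scaling_funK scaling_invK.

End Scaling.

(* Main.v *)
Require Import Defs.
From mathcomp Require Import all_boot all_order all_algebra.
From mathcomp Require Import interval_inference classical_sets reals.
Local Open Scope ring_scope.

Import GRing.Theory Num.Theory.

(** Each $D_r$ is multiplication by a positive constant, the product of the $q_i^{\varepsilon_i}$
    over any expression of $r$ ([scaling_act_eval]). As $D_{rt}=D_t\circ D_r$, periodicity of $x$
    amounts to $D_r(x)=x$ for all $r\in H$, that is, to this constant being 1, because $x\neq 0$.
    [fg_eval_surj] makes expressions reach every $r$. *)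

Lemma fg_eval_surj (S : choiceType) (t : freegroup S) :
  exists w : seq (S * int), fg_eval w = t.
Proof.
pose e (a : S * bool) : S * int := (a.1, if a.2 then - 1 else 1).
(* Evaluating letter by letter performs free reduction, which leaves the reduced word of [t]
   unchanged. *)
have eval_e u : fg_word (fg_eval (map e u)) = pushes u [::].
  rewrite /fg_eval; elim: u => [|[s b] u IHu]; first by rewrite big_nil.
  by rewrite /= big_cons -IHu; case: b.
exists (map e t); apply: val_inj.
by rewrite /= eval_e pushes_reduced ?fg_wordP.
Qed.

Lemma scaling_iterz (R : realType) (S : choiceType) (q : S -> {posnum R})
    (s : S) (k : int) (x : {posnum R}) :
  (md_iterz (scaling_mdtds q) s k x)%:num = (q s)%:num ^ k * x%:num.
Proof.
case: k => n; rewrite /md_iterz /exprz; last rewrite -exprVn.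
  by elim: n => [|n IHn]; rewrite ?mul1r // exprS -mulrA -IHn.
by elim: n.+1 => [|m IHm]; rewrite ?mul1r // exprS -mulrA -IHm.
Qed.

Lemma scaling_act_eval (R : realType) (S : choiceType) (q : S -> {posnum R})
    (w : seq (S * int)) (x : {posnum R}) :
  (md_act (scaling_mdtds q) (fg_eval w) x)%:num =
    (\prod_(a <- w) (q a.1)%:num ^ a.2) * x%:num.
Proof.
rewrite md_act_eval; elim: w x => [|a w IHw] x; first by rewrite big_nil mul1r.
(* The head of [w] acts first, so its factor sits next to [x]; commutativity brings it to the
   front. *)
by rewrite /= IHw scaling_iterz big_cons mulrCA mulrA.
Qed.

Theorem proposition5p1 (R : realType) (S : finType) (p : S -> R)
    (p_gt0 : forall i : S, 0 < p i) (q : S -> {posnum R})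
    (qE : forall i : S, (q i)%:num = 1 + p i / 100%:R)
    (H : set (freegroup S)) (subgroupH : group_closed [in H])
    (x : {posnum R}) :
  periodic (scaling_mdtds q) H x <->
  (forall w : seq (S * int), H (fg_eval w) ->
     \prod_(a <- w) (q a.1)%:num ^ a.2 = 1).
Proof.
have x_neq0 : x%:num != 0 by rewrite lt0r_neq0.
split=> [perx w Hw|prod1 t r].
  (* The time $t=1$ suffices here: it gives $D_r(x)=x$, and [x] cancels. *)
  have := perx 1%g _ Hw; rewrite mulg1 => /(congr1 (fun y => y%:num)).
  by rewrite scaling_act_eval -[RHS]mul1r => /(mulIf x_neq0).
(* Since [r] acts before [t], it is enough that [r] fixes [x]. *)
have [w <-] := fg_eval_surj S r => Hw; rewrite md_actM; congr md_act.
by apply: val_inj; rewrite /= scaling_act_eval prod1 ?mul1r.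
Qed.
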